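(* Let $\mathcal{A}\in T_{m,n}$. Then the following three statements are equivalent: (i) $\mathcal{A}$ is an R$_0$-tensor; (ii) for each $\mathbf{q}\in\mathbb{R}^n$ and each $t,s\in\mathbb{R}$ with $t>0$, the set $$\Gamma(\mathbf{q},s,t)=\{\mathbf{x}\in\mathbb{R}^n:\ \mathbf{x}\ge\mathbf{0},\ \mathbf{q}+\mathcal{A}\mathbf{x}^{m-1}\ge\mathbf{0}\ \text{and}\ \mathbf{x}^\top\mathbf{q}+t\,\mathcal{A}\mathbf{x}^m\le s\}$$ is bounded; (iii) for each $\mathbf{q}\in\mathbb{R}^n$, the solution set of the tensor complementarity problem TCP$(\mathcal{A},\mathbf{q})$ is bounded.
   Context: $T_{m,n}$ denotes the set of all real $m$th order $n$-dimensional tensors $\mathcal{A}=(a_{i_1\cdots i_m})$, $1\le i_1,\dots,i_m\le n$, with order $m\ge 2$ (no symmetry is assumed). For $\mathbf{x}\in\mathbb{R}^n$, $\mathcal{A}\mathbf{x}^{m-1}\in\mathbb{R}^n$ is the vector with components $(\mathcal{A}\mathbf{x}^{m-1})_i=\sum_{i_2,\dots,i_m=1}^n a_{ii_2\cdots i_m}x_{i_2}\cdots x_{i_m}$, and $\mathcal{A}\mathbf{x}^m=\mathbf{x}^\top(\mathcal{A}\mathbf{x}^{m-1})$. For vectors, $\mathbf{x}\ge\mathbf{0}$ means $x_i\ge 0$ for all $i$. For $\mathbf{q}\in\mathbb{R}^n$, TCP$(\mathcal{A},\mathbf{q})$ is the problem of finding $\mathbf{x}\in\mathbb{R}^n$ (a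 solution) with $\mathbf{x}\ge\mathbf{0}$, $\mathbf{q}+\mathcal{A}\mathbf{x}^{m-1}\ge\mathbf{0}$ and $\mathbf{x}^\top(\mathbf{q}+\mathcal{A}\mathbf{x}^{m-1})=0$. $\mathcal{A}$ is an R$_0$-tensor iff TCP$(\mathcal{A},\mathbf{0})$ has a unique solution. *)

(* Defs.v *)
From mathcomp Require Import all_boot all_order all_algebra.
From mathcomp Require Import all_classical all_reals all_analysis.
Import Order.TTheory GRing.Theory Num.Theory numFieldNormedType.Exports.

Set Implicit Arguments.
Unset Strict Implicit.
Unset Printing Implicit Defensive.

Local Open Scope classical_set_scope.
Local Open Scope ring_scope.

(* The entry a_{i_1 ... i_m} is the value at the tuple [i_1; ...; i_m]. *)
Definition tensor (R : realType) (m n : nat) := {ffun m.-tuple 'I_n -> R}.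

Definition nonneg_vec (R : realType) (n : nat) (x : 'cV[R]_n) : Prop :=
  forall i, 0 <= x i 0.

Definition dotv (R : realType) (n : nat) (x y : 'cV[R]_n) : R :=
  (x^T *m y) 0 0.

(* A x^{m-1}.  Summing over the m-tuples I with first index i is summing over
   (i_2, ..., i_m); only orders m >= 1 are meaningful. *)
Definition tensor_vec (R : realType) (m n : nat) (A : tensor R m n)
    (x : 'cV[R]_n) : 'cV[R]_n :=
  \col_i \sum_(I : m.-tuple 'I_n | ohead I == Some i)
    A I * \prod_(j <- behead I) x j 0.

(* A x^m *)
Definition tensor_form (R : realType) (m n : nat) (A : tensor R m n)
    (x : 'cV[R]_n) : R :=
  dotv x (tensor_vec A x).

(* The solution set of TCP(A, q). *)
Definition TCP_sol (R : realType) (m n : nat) (A : tensor R m n)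
    (q : 'cV[R]_n) : set 'cV[R]_n :=
  [set x | [/\ nonneg_vec x,
               nonneg_vec (q + tensor_vec A x) &
               dotv x (q + tensor_vec A x) = 0]].

Definition R0_tensor (R : realType) (m n : nat) (A : tensor R m n) : Prop :=
  exists! x, TCP_sol A 0 x.

Definition Gamma (R : realType) (m n : nat) (A : tensor R m n)
    (q : 'cV[R]_n) (s t : R) : set 'cV[R]_n :=
  [set x | [/\ nonneg_vec x,
               nonneg_vec (q + tensor_vec A x) &
               dotv x q + t * tensor_form A x <= s]].

(* Main.v *)
Require Import Defs.
From mathcomp Require Import all_boot all_order all_algebra.
From mathcomp Require Import all_classical all_reals all_analysis.
From mathcomp Require Import lra.
Import Order.TTheory GRing.Theory Num.Theory numFieldNormedType.Exports.

(** The solution set of TCP(A, 0) is a cone, because x |-> A x^(m-1) is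
    positively homogeneous (of degree m - 1 >= 1), and it contains 0. Such a
    cone is bounded exactly when it is reduced to 0, which gives the step from
    bounded solution sets to the R_0 property ([bounded_TCP_R0]). Since every
    solution of TCP(A, q) lies in Gamma(q, 0, 1), only the step from the R_0
    property to bounded Gamma sets needs analysis.

    For that step, the R_0 property says that no y in the standard simplex has
    A y^(m-1) >= 0 and A y^m <= 0: together with y >= 0 these would force
    A y^m = 0, so that y would be a nonzero solution of TCP(A, 0). The simplex
    is compact and both expressions are continuous, hence there is d > 0 such
    that at each y of the simplex either A y^m >= d or some component of
    A y^(m-1) is at most - d ([R0_simplex_gap]).

    Now write a nonzero x >= 0 as r y with y in the simplex and r the sum of
    the entries of x. The constraints defining Gamma(q, s, t) contain A only
    through r^(m-1) A y^(m-1) and t r^m A y^m, which outgrow the terms in q and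
    s: for r >= 1 each of the two alternatives gives an explicit upper bound on
    r ([R0_Gamma_bounded]), and r dominates the norm of x. *)

Set Implicit Arguments.
Unset Strict Implicit.
Unset Printing Implicit Defensive.

Local Open Scope classical_set_scope.
Local Open Scope ring_scope.

Lemma dotvE (R : realType) (n : nat) (x y : 'cV[R]_n) :
  dotv x y = \sum_i x i 0 * y i 0.
Proof. by rewrite /dotv mxE; apply: eq_bigr => i _; rewrite mxE. Qed.

Lemma dotvDr (R : realType) (n : nat) (x y z : 'cV[R]_n) :
  dotv x (y + z) = dotv x y + dotv x z.
Proof. by rewrite /dotv mulmxDr mxE. Qed.

Lemma dotvZl (R : realType) (n : nat) (c : R) (x y : 'cV[R]_n) :
  dotv (c *: x) y = c * dotv x y.
Proof. by rewrite /dotv linearZ /= -scalemxAl mxE. Qed.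

Lemma dotvZr (R : realType) (n : nat) (c : R) (x y : 'cV[R]_n) :
  dotv x (c *: y) = c * dotv x y.
Proof. by rewrite /dotv -scalemxAr mxE. Qed.

Lemma tensor_vecZ (R : realType) (m n : nat) (A : tensor R m n) (c : R)
    (x : 'cV[R]_n) :
  tensor_vec A (c *: x) = c ^+ m.-1 *: tensor_vec A x.
Proof.
apply/colP => i; rewrite !mxE mulr_sumr; apply: eq_bigr => I _.
under eq_bigr do rewrite mxE.
rewrite big_split /= big_const_seq count_predT size_behead size_tuple.
by rewrite -Monoid.iteropE -/(c ^+ m.-1) mulrCA.
Qed.

Lemma tensor_formZ (R : realType) (m n : nat) (A : tensor R m n) (c : R)
    (x : 'cV[R]_n) : (0 < m)%N ->
  tensor_form A (c *: x) = c ^+ m * tensor_form A x.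
Proof.
case: m A => // m A _.
by rewrite /tensor_form tensor_vecZ dotvZl dotvZr mulrA -exprS.
Qed.

Lemma TCP_sol0Z (R : realType) (m n : nat) (A : tensor R m n) (c : R)
    (x : 'cV[R]_n) :
  0 <= c -> TCP_sol A 0 x -> TCP_sol A 0 (c *: x).
Proof.
move=> c0 [x0]; rewrite /TCP_sol /= !add0r => Ax0 xAx; split.
- by move=> i; rewrite mxE mulr_ge0.
- by move=> i; rewrite tensor_vecZ mxE mulr_ge0 ?exprn_ge0.
- by rewrite tensor_vecZ dotvZl dotvZr xAx !mulr0.
Qed.

Lemma TCP_sol00 (R : realType) (m n : nat) (A : tensor R m n) :
  (2 <= m)%N -> TCP_sol A 0 0.
Proof.
move=> m2; have A0 : tensor_vec A 0 = 0.
  case: m A m2 => [|[|k]] // A _.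
  by have := tensor_vecZ A 0 0; rewrite exprS mul0r !scale0r.
rewrite /TCP_sol /= A0 addr0; split; [by move=> i; rewrite mxE.. |].
by rewrite dotvE big1 // => i _; rewrite mxE mul0r.
Qed.

(** The normalization by the sum of the entries is preferred to one by the norm:
    on the nonnegative orthant it is linear, and it bounds every entry by 1. *)
Definition simplex (R : realType) (n : nat) : set 'cV[R]_n :=
  [set y | nonneg_vec y /\ \sum_i y i 0 = 1].

Lemma tensor_vec_continuous (R : realType) (m n : nat) (A : tensor R m n) i :
  continuous (fun x : 'cV[R]_n => tensor_vec A x i 0).
Proof.
under [X in continuous X]eq_fun do rewrite mxE.
apply: (continuous_big (@add_continuous R)) => I _ x.
apply: (@continuousM _ _ (cst (A I))); first exact: cst_continuous.
exact: (continuous_big (@mul_continuous R)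
  (fun j _ => @coord_continuous R _ _ j 0)).
Qed.

Lemma tensor_form_continuous (R : realType) (m n : nat) (A : tensor R m n) :
  continuous (fun x : 'cV[R]_n => tensor_form A x).
Proof.
under [X in continuous X]eq_fun do rewrite /tensor_form dotvE.
apply: (continuous_big (@add_continuous R)) => i _ x.
by apply: continuousM; [exact: coord_continuous | exact: tensor_vec_continuous].
Qed.

Lemma trmx_continuous (R : realType) (m n : nat) :
  continuous (@trmx R m n).
Proof.
move=> x B /= /(nbhs_ballP (x^T)) [e e0 eB]; apply/nbhs_ballP.
exists e => // y [_ xy] /=; apply: eB; split => // i j; rewrite !mxE.
exact: xy.
Qed.

(** Tychonoff's theorem gives the compactness of boxes of row vectors; it is
    transported to columns by the continuity of the transpose. *)
Lemma simplex_compact (R : realType) (n : nat) : compact (@simplex R n).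
Proof.
pose box := [set v : 'rV[R]_n | forall i, `[0, 1]%classic (v ord0 i)].
have box_compact : compact box.
  apply: (@rV_compact R n (fun=> `[0, 1]%classic)) => i.
  exact: segment_compact.
have trbox_compact : compact (trmx @` box).
  apply: continuous_compact box_compact.
  by apply: continuous_subspaceT; exact: trmx_continuous.
apply: subclosed_compact trbox_compact _.
  have -> : @simplex R n =
      \bigcap_(i in setT) ((fun y : 'cV[R]_n => y i 0) @^-1` [set z | 0 <= z])
      `&` ((fun y : 'cV[R]_n => \sum_i y i 0) @^-1` [set z | z = 1]).
    by apply/seteqP; split => y [y0 y1]; split => // i; [move=> _ |]; exact: y0.
  apply: closedI.
    apply: closed_bigI => i _; apply: preimage_closed (@closed_ge _ _) => x _.
    exact: coord_continuous.
  apply: preimage_closed (@closed_eq _ _) => x _.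
  exact: (continuous_big (@add_continuous R)
    (fun j _ => @coord_continuous R _ _ j 0)).
move=> y [y0 y1]; exists y^T; last by rewrite trmxK.
move=> i /=; rewrite mxE in_itv /= y0 /= -y1 (bigD1 i) //= lerDl.
by apply: sumr_ge0 => j _; exact: y0.
Qed.

(** Compactness upgrades the pointwise failure of the homogeneous problem on the
    simplex to a uniform one: d is the minimum there of the larger of A y^m and
    the greatest component of - A y^(m-1). *)
Lemma R0_simplex_gap (R : realType) (m n : nat) (A : tensor R m n) :
  (2 <= m)%N -> R0_tensor A ->
  exists2 d : R, 0 < d & forall y, simplex y ->
    d <= tensor_form A y \/ exists i, d <= - tensor_vec A y i 0.
Proof.
move=> m2 [x0 [_ uniq_x0]].
(* The base value 0 of the big maximum is harmless: g is shown to be positive on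
   the simplex, so 0 is never the maximum there. *)
pose g (y : 'cV[R]_n) :=
  Num.max (tensor_form A y) (\big[Num.max/0]_i - tensor_vec A y i 0).
have g_gt0 y : simplex y -> 0 < g y.
  move=> [y0 y1]; rewrite ltNge; apply/negP; rewrite ge_max => /andP[form_le0].
  move=> /bigmax_leP[_ vec_le0].
  have vec_ge0 i : 0 <= tensor_vec A y i 0 by rewrite -oppr_le0 vec_le0.
  have ysol : TCP_sol A 0 y.
    split => //; rewrite add0r //; apply/eqP; rewrite eq_le form_le0 /= dotvE.
    by apply: sumr_ge0 => i _; rewrite mulr_ge0.
  have y_eq0 : y = 0 by rewrite -(uniq_x0 _ ysol) (uniq_x0 _ (TCP_sol00 _ m2)).
  move: y1; rewrite y_eq0 big1 => [/esym/eqP|i _]; last by rewrite mxE.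
  by rewrite oner_eq0.
have g_cont : continuous g.
  have max_cont : continuous (fun z : R * R => Num.max z.1 z.2).
    move=> z; apply: (@continuous_max _ _ fst snd).
      exact: cvg_fst.
    exact: cvg_snd.
  move=> y; apply: continuous_max; first exact: tensor_form_continuous.
  apply: (continuous_big max_cont) => i _ z.
  by apply: continuousN; exact: tensor_vec_continuous.
(* The simplex is empty when n = 0; any d then works. *)
have [simplex0|/set0P simplexN0] := eqVneq (@simplex R n) set0.
  by exists 1 => // y; rewrite simplex0.
have [c cS cmin] := compact_EVT_min simplexN0 (@simplex_compact R n)
  (continuous_subspaceT g_cont).
have {}g_gt0 := g_gt0 c (set_mem cS).
exists (g c) => // y yS; have := cmin y (mem_set yS).
rewrite [in X in _ <= X]/g le_max => /orP[|]; first by left.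
by move=> /bigmax_geP[|[i _ gi]]; [rewrite leNgt g_gt0 | right; exists i].
Qed.

Lemma mx_norm_le_sum (R : realType) (n : nat) (x : 'cV[R]_n) :
  nonneg_vec x -> `|x| <= \sum_i x i 0.
Proof.
move=> x0; rewrite /Num.norm /= mx_normrE.
apply/bigmax_leP; split => [|[i j] _] /=.
  by apply: sumr_ge0 => i _; exact: x0.
rewrite ord1 ger0_norm // (bigD1 i) //= lerDl.
by apply: sumr_ge0 => k _; exact: x0.
Qed.

(** For x = r y with y in the simplex and r > 1, either
    0 <= q_i - r^(m-1) d for some i, whence r <= Q / d, or
    r y^T q + t r^m d <= s, whence r <= (|s| + Q) / (t d), where Q is the sum of
    the |q_i|. Both rely on r <= r^(m-1), that is on m >= 2. *)
Lemma R0_Gamma_bounded (R : realType) (m n : nat) (A : tensor R m n)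
    (q : 'cV[R]_n) (s t : R) :
  (2 <= m)%N -> R0_tensor A -> 0 < t -> bounded_set (Gamma A q s t).
Proof.
move=> m2 AR0 t0; have [d d0 gap] := R0_simplex_gap m2 AR0.
pose Q := \sum_i `|q i 0|.
have Q_ge0 : 0 <= Q by apply: sumr_ge0.
have q_le_Q i : q i 0 <= Q.
  by rewrite (le_trans (ler_norm _)) // /Q (bigD1 i) //= lerDl sumr_ge0.
pose B := 1 + Q / d + (`|s| + Q) / (t * d).
have Q1 : 0 <= Q / d by rewrite divr_ge0 // ltW.
have Q2 : 0 <= (`|s| + Q) / (t * d).
  by rewrite divr_ge0 ?addr_ge0 // mulr_ge0 // ltW.
suff GammaB x : Gamma A q s t x -> `|x| <= B.
  exists B; split; first exact: num_real.
  by move=> M BM x /GammaB xB; exact: le_trans xB (ltW BM).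
move=> [x0 Ax0 xs]; apply: le_trans (mx_norm_le_sum x0) _.
set r := \sum_i x i 0.
have [r1|r1] := leP r 1.
  by rewrite /B (le_trans r1) // -addrA lerDl addr_ge0.
have r0 : 0 < r by exact: lt_trans r1.
pose y := r^-1 *: x.
have xE : x = r *: y by rewrite scalerA divff ?gt_eqF // scale1r.
have y0 : nonneg_vec y by move=> i; rewrite mxE mulr_ge0 // invr_ge0 ltW.
have yS : simplex y.
  split => //; under eq_bigr do rewrite mxE.
  by rewrite -mulr_sumr mulVf // gt_eqF.
have r_le_rm : r <= r ^+ m.-1.
  by rewrite -[leLHS]expr1 ler_eXn2l // -ltnS prednK // ltnW.
have [form_ge|[i vec_le]] := gap y yS; last first.
  suff rQ : r <= Q / d.
    by rewrite /B (le_trans rQ) // -addrA addrCA lerDl addr_ge0.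
  rewrite ler_pdivlMr //; apply: le_trans (q_le_Q i).
  have := Ax0 i; rewrite xE tensor_vecZ !mxE -lerBlDr sub0r -mulrN.
  move/(le_trans _); apply.
  rewrite mxE in vec_le.
  by apply: ler_pM => //; exact: ltW.
suff rQ : r <= (`|s| + Q) / (t * d).
  by rewrite /B (le_trans rQ) // lerDr addr_ge0.
rewrite ler_pdivlMr ?mulr_gt0 //.
have yq : - Q <= dotv y q.
  rewrite dotvE /Q -sumrN; apply: ler_sum => i _.
  rewrite -lerNl -mulrN (le_trans (ler_norm _)) // normrM normrN.
  rewrite ler_piMl // ger0_norm //.
  have [_ <-] := yS; rewrite (bigD1 i) //= lerDl.
  by apply: sumr_ge0 => j _; exact: y0.
(* The constraint xs carries one more power of r than the goal, since A y^m has
   degree m while the bound needs only r <= r^(m-1). *)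
rewrite -(ler_pM2l r0).
move: xs; rewrite {1 2}xE dotvZl tensor_formZ ?(ltnW m2) //.
rewrite -[in r ^+ m](prednK (ltnW m2)) exprS => xs.
have s_le : s <= r * `|s|.
  by rewrite (le_trans (ler_norm s)) // ler_peMl // ltW.
have key : r * (r * (t * d)) <= r * (r ^+ m.-1 * (t * tensor_form A y)).
  rewrite ler_pM2l //; apply: ler_pM => //; first exact: ltW.
    by rewrite mulr_ge0 // ltW.
  by rewrite ler_pM2l.
have : r * - Q <= r * dotv y q by rewrite ler_pM2l.
lra.
Qed.

(** A nonzero solution of TCP(A, 0) would span a ray of solutions. *)
Lemma bounded_TCP_R0 (R : realType) (m n : nat) (A : tensor R m n) :
  (2 <= m)%N -> bounded_set (TCP_sol A 0) -> R0_tensor A.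
Proof.
move=> m2 [M [_ boundM]]; exists 0; split; first exact: TCP_sol00.
move=> x xsol; apply/esym/eqP; apply: contraT => xN0.
have x_gt0 : 0 < `|x| by rewrite normr_gt0.
(* With this scaling the norm of c *: x is |M| + 2, above the bound |M| + 1. *)
pose c := (`|M| + 2) / `|x|.
have c0 : 0 <= c by rewrite divr_ge0 // addr_ge0.
have := boundM (`|M| + 1) _ _ (TCP_sol0Z c0 xsol).
rewrite (le_lt_trans (ler_norm M)) ?ltrDl // => /(_ isT).
by rewrite /= normrZ ger0_norm // divfK ?gt_eqF //; lra.
Qed.

Lemma TCP_sol_sub_Gamma (R : realType) (m n : nat) (A : tensor R m n)
    (q : 'cV[R]_n) : TCP_sol A q `<=` Gamma A q 0 1.
Proof.
by move=> x [x0 Ax0 xAx]; split => //; rewrite mul1r -dotvDr xAx.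
Qed.

Theorem theorem3p3 (R : realType) (m n : nat) (A : tensor R m n)
    (hm : (2 <= m)%N) :
  [<-> R0_tensor A;
       forall (q : 'cV[R]_n) (t s : R), 0 < t -> bounded_set (Gamma A q s t);
       forall q : 'cV[R]_n, bounded_set (TCP_sol A q)].
Proof.
tfae.
- by move=> AR0 q t s; exact: R0_Gamma_bounded.
- move=> GammaB q; have [M [Mreal boundM]] := GammaB q 1 0 ltr01.
  by exists M; split => // N MN x /TCP_sol_sub_Gamma; exact: boundM.
- by move=> solB; exact: bounded_TCP_R0.
Qed.
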